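(* Let $n\ge 2$ and let $H_n=H_{1\times 1\times n}$ be the graph of a line of $n$ hexagons. Then the perfect matching complex $\mathcal{M}_p(H_n)$ is contractible.
   Context: For a finite simple graph $G$, a perfect matching is a set of edges of $G$, pairwise vertex-disjoint, covering every vertex. The perfect matching complex $\mathcal{M}_p(G)$ is the simplicial complex whose vertex set is the edge set $E(G)$ and in which a set $\sigma\subseteq E(G)$ is a face if and only if $\sigma\subseteq P$ for some perfect matching $P$ of $G$ (so its facets are the perfect matchings). The line of $n$ hexagons $H_{1\times 1\times n}$ is the planar graph consisting of $n$ hexagonal cells $T_1,\dots,T_n$ of the hexagonal lattice arranged in a straight chain: $T_k$ and $T_{k+1}$ share exactly one edge, and for $2\le k\le n-1$ the edge $T_k$ shares with $T_{k-1}$ is opposite (in the hexagon $T_k$) to the edge it shares with $T_{k+1}$; its vertices and edges are those of the hexagons ($4n+2$ vertices, $5n+1$ edges). *)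

(* Defs.v *)
From mathcomp Require Import all_boot all_order all_algebra.
From mathcomp Require Import all_classical all_reals all_analysis.
Import Order.TTheory GRing.Theory Num.Theory numFieldNormedType.Exports.

Set Implicit Arguments.
Unset Strict Implicit.
Unset Printing Implicit Defensive.

(* Edges are two-element sets of vertices: no loops, no multiple edges. *)
Record sgraph := SGraph {
  vertex :> finType;
  edges : {set {set vertex}};
  edges_card2 : forall e, e \in edges -> #|e| = 2
}.

Definition edge (G : sgraph) : finType := {e : {set G} | e \in edges G}.

Definition perfect_matching (G : sgraph) (P : {set edge G}) : bool :=
  [forall e in P, forall f in P, (e != f) ==> [disjoint val e & val f]] &&
  [forall v : G, exists e in P, v \in val e].

(* Abstract simplicial complexes with vertices in T; the empty simplex may be
   a face, and an element of T need not be one. *)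
Record scomplex (T : finType) := SComplex {
  faces : {set {set T}};
  faces_sub : forall s t : {set T}, s \in faces -> t \subset s -> t \in faces
}.

Section PerfectMatchingComplex.
Variable G : sgraph.

Definition pm_faces : {set {set edge G}} :=
  [set s : {set edge G} |
     [exists P : {set edge G}, perfect_matching P && (s \subset P)]]%SET.

Lemma pm_faces_sub (s t : {set edge G}) :
  s \in pm_faces -> t \subset s -> t \in pm_faces.
Proof.
rewrite !inE => /existsP[P /andP[pmP sP]] ts.
by apply/existsP; exists P; rewrite pmP (fintype.subset_trans ts sP).
Qed.

Definition perfect_matching_complex : scomplex (edge G) :=
  SComplex pm_faces_sub.

End PerfectMatchingComplex.

Section HexagonLine.
Variable n : nat.

(* In the brick-wall drawing of the hexagonal lattice, the chain is a strip of
   two rows (true and false) and columns 0, ..., 2n.  The k-th cell, k < n,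
   spans columns 2k, 2k+1 and 2k+2; its vertices are listed in cyclic order, so
   the first and second edges are in the row true, the fourth and fifth in the
   row false, and the third and sixth are the opposite vertical edges in columns
   2k+2 and 2k, the ones shared with the cells k+1 and k-1. *)
Definition hexline_vertex : finType := ('I_(n.*2.+1) * bool)%type.

Definition hexagon (k : nat) : seq hexline_vertex :=
  [:: (inord k.*2, true); (inord k.*2.+1, true); (inord k.*2.+2, true);
      (inord k.*2.+2, false); (inord k.*2.+1, false); (inord k.*2, false)].

Definition cycle_edges (c : seq hexline_vertex) : {set {set hexline_vertex}} :=
  [set [set x; next c x] | x in c]%SET.

Definition hexline_edges : {set {set hexline_vertex}} :=
  (\bigcup_(k < n) cycle_edges (hexagon k))%SET.

Lemma hexline_edges_card2 e : e \in hexline_edges -> #|e| = 2.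
Proof.
move=> /bigcupP[k _ /imsetP[x xk ->]]; rewrite cards2.
suff -> : x != next (hexagon k) x by [].
have lek : k.*2.+2 <= n.*2 by rewrite -doubleS leq_double.
have neq_col i j : i <= n.*2 -> j < i ->
    (inord i == inord j :> 'I_(n.*2.+1)) = false.
  by move=> le_i lt_ji; rewrite -val_eqE /= !inordK ?gtn_eqF // ltnS
    (leq_trans (ltnW lt_ji)).
move: xk; rewrite /hexagon !inE.
have := neq_col _ _ lek (ltnSn _); have := neq_col _ _ lek (ltnW (ltnSn _)).
have := neq_col _ _ (ltnW lek) (ltnSn _).
move: (inord k.*2) (inord k.*2.+1) (inord k.*2.+2) => a b c ba ca cb.
have [ab ac bc] : [/\ (a == b) = false, (a == c) = false & (b == c) = false].
  by split; rewrite eq_sym.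
by do 5?[case/orP]; move/eqP->;
   rewrite /= !xpair_eqE ?eqxx ?ab ?ac ?bc ?ba ?ca ?cb /= ?xpair_eqE
           ?eqxx ?ab ?ac ?bc ?ba ?ca ?cb.
Qed.

Definition hexagon_line : sgraph := SGraph hexline_edges_card2.

End HexagonLine.

Local Open Scope classical_set_scope.
Local Open Scope ring_scope.

(* Barycentric coordinates, with the topology of R^T; for a finite complex this
   is the usual topology of the realization. *)
Definition realization_set (R : realType) (T : finType) (K : scomplex T) :
    set {ptws T -> R} :=
  [set x | [/\ forall v, 0 <= x v, \sum_v x v = 1
             & [set v | x v != 0]%SET \in faces K]].

Definition realization (R : realType) (T : finType) (K : scomplex T) :
    topologicalType :=
  set_type (@realization_set R T K).

Definition homotopic (R : realType) (X Y : topologicalType) (f g : X -> Y) :=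
  exists H : X * R -> Y,
    [/\ {within [set: X] `*` `[0, 1], continuous H},
        forall x, H (x, 0) = f x & forall x, H (x, 1) = g x].

Definition contractible (R : realType) (X : topologicalType) :=
  exists x0 : X, homotopic R (@id X) (fun=> x0).

(* Main.v *)
Require Import Defs.
From mathcomp Require Import all_boot all_order all_algebra.
From mathcomp Require Import all_classical all_reals all_analysis.
From mathcomp Require Import zify lra.
Import Order.TTheory GRing.Theory Num.Theory numFieldNormedType.Exports.

Set Implicit Arguments.
Unset Strict Implicit.
Unset Printing Implicit Defensive.

(* Let [a], [b], [a'], [b'] be the row edges of the last hexagon ([a], [a'] the
   left ones) and [v] its free rung.  A perfect matching contains either [b] and
   [b'] or else [a], [a'] and [v]; in the second case it also contains the edge
   [w] of the previous hexagon which ends next to [a], and rotating the last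
   hexagon gives a perfect matching through [b].  Hence the simplicial map which
   sends [a], [a'] and [v] to [w] and fixes all other edges is contiguous both
   to the identity and to the constant map [b]. *)

(** * Contraction of a complex along two contiguities *)

Section ContiguousContraction.
Local Open Scope classical_set_scope.
Local Open Scope ring_scope.

(** The topology of pointwise convergence is the supremum of the initial topologies of the
    evaluations. *)
Lemma continuous_ptws (X Y : topologicalType) (I : choiceType)
    (F : X -> {ptws I -> Y}) :
  (forall i, continuous (fun x => F x i)) -> continuous F.
Proof.
move=> Fc x; apply/cvg_sup => i.
exact: (@continuous_comp_initial _ _ _ (fun f : I -> Y => f i) F (Fc i) x).
Qed.

Variables (R : realType) (T : finType) (K : scomplex T) (f : T -> T) (b : T).

(** A homotopy is a function of all real times. Truncated weights keep [contraction] in the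
    realization outside [[0, 1]] too, so that it is continuous globally and can be restricted. *)
Definition clamp (u : R) : R := Num.min 1 (Num.max 0 u).

Lemma clamp_continuous : continuous clamp.
Proof.
move=> u; apply: (@continuous_min R _ (cst 1)); first exact: cvg_cst.
by apply: (@continuous_max R _ (cst 0) id); [exact: cvg_cst | exact: cvg_id].
Qed.

Lemma clamp_le0 (u : R) : u <= 0 -> clamp u = 0.
Proof. by move=> u0; rewrite /clamp max_l// min_r. Qed.

Lemma clamp_ge1 (u : R) : 1 <= u -> clamp u = 1.
Proof. by move=> u1; rewrite /clamp max_r ?min_l//; lra. Qed.

Lemma clamp_id (u : R) : 0 <= u <= 1 -> clamp u = u.
Proof. by case/andP=> u0 u1; rewrite /clamp max_r// min_r. Qed.

(* Straight lines from [x] to its image under the simplicial map [f] for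
   [t <= 1/2], and from there to the vertex [b] for [t >= 1/2]. *)
Definition contraction (x : T -> R) (t : R) (w : T) : R :=
  clamp (1 - 2 * t) * x w
  + (1 - clamp (1 - 2 * t) - clamp (2 * t - 1)) * (\sum_(u | f u == w) x u)
  + clamp (2 * t - 1) * (w == b)%:R.

(** The last alternative says that the weights of [x] and of [b] are never both positive: the two
    stages of the homotopy do not overlap. *)
Lemma contraction_weights (t : R) :
  [/\ 0 <= clamp (1 - 2 * t), 0 <= clamp (2 * t - 1),
      0 <= 1 - clamp (1 - 2 * t) - clamp (2 * t - 1)
    & clamp (1 - 2 * t) = 0 \/ clamp (2 * t - 1) = 0].
Proof.
have [t0|t0] := lerP t 0.
  by rewrite clamp_ge1 1?clamp_le0; try lra; split; (right; lra) || lra.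
have [t1|t1] := lerP t (1 / 2).
  by rewrite clamp_id 1?clamp_le0; try lra; split; (right; lra) || lra.
rewrite clamp_le0; last by lra.
have [t2|t2] := lerP t 1.
  by rewrite clamp_id; try lra; split; (left; lra) || lra.
by rewrite clamp_ge1; try lra; split; (left; lra) || lra.
Qed.

Lemma sum_vertex : \sum_w (w == b)%:R = 1 :> R.
Proof. by rewrite (bigD1 b) //= eqxx big1 ?addr0 // => w /negPf->. Qed.

Hypotheses (Kf : forall s, s \in faces K -> (s :|: f @: s)%SET \in faces K)
           (Kb : forall s, s \in faces K -> (b |: f @: s)%SET \in faces K).

(** If [s] is the support of [x], the moving point is supported in the union of [s] and [f @: s] in
    the first stage, and of [f @: s] and [b] in the second. These are faces by [Kf] and [Kb], the
    contiguity of [f] to the identity and to the constant map [b]. *)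
Lemma contraction_realization (x : T -> R) (t : R) :
  realization_set K x -> realization_set K (contraction x t).
Proof.
case=> x0 x1 xK; have [a0 c0 b0 ac] := contraction_weights t.
rewrite /realization_set /contraction.
move: (clamp _) (clamp _) a0 c0 b0 ac => al ga al0 ga0 be0 alga; split => /=.
- move=> w; rewrite !addr_ge0 ?mulr_ge0 ?ler0n//.
  by apply: sumr_ge0 => u _; exact: x0.
- rewrite !big_split /= -!mulr_sumr x1.
  (* The fibres of [f] partition the total mass of [x]. *)
  have -> : \sum_w \sum_(u | f u == w) x u = 1.
    by rewrite -x1 [RHS](partition_big f predT).
  by rewrite sum_vertex; lra.
set s := [set v | x v != 0]%SET in xK.
have sum0 w : w \notin f @: s -> \sum_(u | f u == w) x u = 0.
  move=> wfs; apply: big1 => u /eqP fuw; apply/eqP; apply: contraNT wfs => xu.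
  by apply/imsetP; exists u; rewrite ?inE.
case: alga => [al0E|ga0E].
- apply: faces_sub (Kb xK) _; apply/fintype.subsetP => w; rewrite !inE.
  apply: contraNT; rewrite negb_or => /andP[wb /sum0 ->].
  by rewrite (negPf wb) al0E mul0r !mulr0 !addr0.
apply: faces_sub (Kf xK) _; apply/fintype.subsetP => w; rewrite !inE.
apply: contraNT; rewrite negb_or negbK => /andP[/eqP-> /sum0 ->].
by rewrite ga0E mul0r !mulr0 !addr0.
Qed.

Definition realization_point (x : {ptws T -> R}) (xK : realization_set K x) :
    realization R K :=
  exist (fun y : {ptws T -> R} => y \in realization_set K) x (mem_set xK).

Lemma contraction_continuous :
  continuous (fun p : realization R K * R =>
                contraction (\val p.1) p.2 : {ptws T -> R}).
Proof.
apply: continuous_ptws => w.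
have xc u : continuous (fun p : realization R K * R => \val p.1 u).
  move=> p.
  apply: (@continuous_comp (realization R K * R)%type (realization R K) R fst
            (fun y => \val y u)); first exact: cvg_fst.
  apply: (@continuous_comp (realization R K) {ptws T -> R} R \val
            (fun y => y u)); first exact: initial_continuous.
  exact: (@proj_continuous T (fun=> R)).
have clc (h : R -> R) : continuous h ->
    continuous (fun p : realization R K * R => clamp (h p.2)).
  move=> hc p; apply: (@continuous_comp _ _ _ snd (clamp \o h)).
    exact: cvg_snd.
  by apply: continuous_comp; [exact: hc | exact: clamp_continuous].
have alc : continuous (fun p : realization R K * R => clamp (1 - 2 * p.2)).
  apply: (clc (fun t => 1 - 2 * t)) => t.
  apply: cvgB; first exact: cvg_cst.
  by apply: cvgM; [exact: cvg_cst | exact: cvg_id].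
have gac : continuous (fun p : realization R K * R => clamp (2 * p.2 - 1)).
  apply: (clc (fun t => 2 * t - 1)) => t.
  apply: cvgB; last exact: cvg_cst.
  by apply: cvgM; [exact: cvg_cst | exact: cvg_id].
move=> p; apply: cvgD; last by apply: cvgM; [exact: gac | exact: cvg_cst].
apply: cvgD; first by apply: cvgM; [exact: alc | exact: xc].
apply: cvgM.
  by apply: cvgB; [apply: cvgB; [exact: cvg_cst | exact: alc] | exact: gac].
by apply: cvg_big => [|u _]; [exact: add_continuous | exact: xc].
Qed.

Lemma contractible_of_contiguous :
  finset.set0 \in faces K -> contractible R (realization R K).
Proof.
move=> K0.
have bR : realization_set K (fun w => (w == b)%:R : R).
  split=> [w||]; first exact: ler0n.
    exact: sum_vertex.
  (* Applied to the empty face, [Kb] shows that [b] is a vertex of the complex. *)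
  apply: faces_sub (Kb K0) _; apply/fintype.subsetP => w; rewrite !inE.
  by case: (w == b) => //; rewrite eqxx.
exists (realization_point bR).
exists (fun p =>
  realization_point (contraction_realization p.2 (set_mem (valP p.1)))).
split.
- apply: continuous_subspaceT; apply: continuous_comp_initial.
  exact: contraction_continuous.
- move=> x; apply/val_inj/funext => w /=.
  rewrite /contraction !mulr0 subr0 (@clamp_ge1 1)// sub0r.
  by rewrite clamp_le0 ?lerN10//; lra.
- move=> x; apply/val_inj/funext => w /=.
  rewrite /contraction mulr1 (@clamp_le0 (1 - 2)); last by lra.
  rewrite (_ : 2 - 1 = 1) ?(@clamp_ge1 1)//; lra.
Qed.

End ContiguousContraction.

(** * Constructing and modifying perfect matchings *)

Section PerfectMatchings.
Variable G : sgraph.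
Implicit Types (P A B : {set edge G}) (e f : edge G) (v : G).

Lemma edge_neq v e f : v \in val e -> v \notin val f -> e <> f.
Proof. by move=> ve vf ef; rewrite -ef ve in vf. Qed.

Lemma perfect_matchingP P :
  reflect ((forall e f v, e \in P -> f \in P -> v \in val e -> v \in val f ->
              e = f) /\
           (forall v, exists2 e, e \in P & v \in val e))
          (perfect_matching P).
Proof.
apply: (iffP andP) => [[/forall_inP dj /forallP cv]|[dj cv]]; split.
- move=> e f v eP fP ve vf; apply/eqP; apply/negPn/negP => ef.
  have /forall_inP/(_ f fP) := dj e eP; rewrite ef /= => /pred0P/(_ v) /=.
  by rewrite ve vf.
- by move=> v; apply/exists_inP; exact: cv.
- apply/forall_inP => e eP; apply/forall_inP => f fP; apply/implyP => ef.
  apply/pred0P => v /=; apply/negP => /andP[ve vf].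
  by rewrite (dj e f v) ?eqxx in ef.
- by apply/forallP => v; apply/exists_inP; exact: cv.
Qed.

(** As [mu] is an involution, any pair [{z, mu z}] containing [v] equals [{v, mu v}], so two pairs
    that meet coincide. *)
Lemma perfect_matching_of_involution (mu : G -> G) :
  involutive mu -> (forall v, [set v; mu v]%SET \in edges G) ->
  perfect_matching [set e : edge G | val e \in [set [set v; mu v] | v : G]]%SET.
Proof.
move=> muK muE; apply/perfect_matchingP; split=> [e f v|v].
  rewrite !inE => /imsetP[x _ ex] /imsetP[y _ fy] ve vf; apply: val_inj.
  have E z : v \in [set z; mu z]%SET -> [set z; mu z]%SET = [set v; mu v]%SET.
    by rewrite !inE => /orP[/eqP->|/eqP->] //; rewrite muK finset.setUC.
  rewrite ex in ve *; rewrite fy in vf *.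
  by rewrite (E _ ve) (E _ vf).
exists (exist (fun e : {set G} => e \in edges G) _ (muE v)).
  by rewrite inE /=; apply/imsetP; exists v.
by rewrite /= !inE eqxx.
Qed.

(** [A] and [B] cover the same vertices, and the edges of [P] outside [A] avoid them. *)
Lemma perfect_matching_exchange P A B :
    perfect_matching P -> (A \subset P)%SET ->
    (forall e f v, e \in B -> f \in B -> v \in val e -> v \in val f -> e = f) ->
    (forall v, [exists e in A, v \in val e] = [exists e in B, v \in val e]) ->
  perfect_matching ((P :\: A) :|: B)%SET.
Proof.
move=> /perfect_matchingP[djP cvP] /fintype.subsetP AP djB AB.
(* The common vertex also lies on some [g] in [A]; since [e] and [g] meet inside [P], they are
   equal. *)
have sep e f v : e \in P -> e \notin A -> f \in B -> v \in val e ->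
    v \in val f -> False.
  move=> eP eA fB ve vf.
  have : [exists f in B, v \in val f] by apply/exists_inP; exists f.
  rewrite -AB => /exists_inP[g gA vg].
  by rewrite (djP e g v eP (AP g gA) ve vg) gA in eA.
apply/perfect_matchingP; split=> [e f v|v].
  rewrite !inE => /orP[/andP[eA eP]|eB] /orP[/andP[fA fP]|fB] ve vf.
  - exact: djP ve vf.
  - by case: (sep e f v).
  - by case: (sep f e v).
  - exact: djB ve vf.
have [e eP ve] := cvP v; have [eA|eA] := boolP (e \in A); last first.
  by exists e; rewrite // !inE eA eP.
have : [exists e in A, v \in val e] by apply/exists_inP; exists e.
by rewrite AB => /exists_inP[f fB vf]; exists f; rewrite // inE fB orbT.
Qed.

End PerfectMatchings.

(** * Contractibility from a pendant hexagon *)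

(* A hexagon [p0 p1 p2 q2 q1 q0] attached to the rest of [G] at [p0] and [q0]
   only, such that [p0] has a neighbour [r] of degree two. *)
Section PendantHexagon.
Variables (G : sgraph) (p0 p1 p2 q0 q1 q2 r : G).
Variables (u v w a b a' b' : edge G).
Hypotheses (uniq_pq : uniq [:: p0; p1; p2; q0; q1; q2; r])
  (uE : val u = [set p0; q0]%SET) (vE : val v = [set p2; q2]%SET)
  (aE : val a = [set p0; p1]%SET) (bE : val b = [set p1; p2]%SET)
  (a'E : val a' = [set q0; q1]%SET) (b'E : val b' = [set q1; q2]%SET)
  (p1E : forall e : edge G, p1 \in val e -> e = a \/ e = b)
  (p2E : forall e : edge G, p2 \in val e -> e = b \/ e = v)
  (q1E : forall e : edge G, q1 \in val e -> e = a' \/ e = b')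
  (q2E : forall e : edge G, q2 \in val e -> e = b' \/ e = v)
  (rw : r \in val w)
  (rE : forall e : edge G, r \in val e -> p0 \in val e \/ e = w).

Let memE := (uE, vE, aE, bE, a'E, b'E, inE, eqxx, orbT).

(** A false incidence amounts to the coincidence of two of the seven listed vertices, which
    [uniq_pq] excludes. *)
Ltac distinct :=
  let E := fresh in
  rewrite ?memE /=; repeat (case/orP); move=> /eqP E;
  move: uniq_pq; rewrite E /= !inE !eqxx ?orbT ?andbF //.

(** The choice between [a] and [b] at [p1] propagates through [p2], [q2] and [q1], each of which has
    only two possible edges. *)
Lemma pendant_matching (P : {set edge G}) : perfect_matching P ->
    [/\ b \in P, a \notin P, a' \notin P & v \notin P]
 \/ [/\ a \in P, a' \in P, v \in P & w \in P].
Proof.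
move=> /perfect_matchingP[dj cv].
have ab : a <> b.
  by apply: (@edge_neq _ p0); rewrite ?memE //; apply/negP; distinct.
have ab' : a' <> b'.
  by apply: (@edge_neq _ q0); rewrite ?memE //; apply/negP; distinct.
have vb : v <> b.
  by apply: (@edge_neq _ q2); rewrite ?memE //; apply/negP; distinct.
have vb' : v <> b'.
  by apply: (@edge_neq _ p2); rewrite ?memE //; apply/negP; distinct.
have [aP|aP] := boolP (a \in P).
  right.
  have bP : b \notin P.
    by apply/negP => bP; apply: ab; apply: (dj _ _ p1); rewrite ?memE.
  have vP : v \in P.
    have [e eP /p2E[eb|<-//]] := cv p2; by rewrite -eb eP in bP.
  have a'P : a' \in P.
    have [e eP /q1E[<-//|eb']] := cv q1; rewrite {}eb' in eP.
    by case: vb'; apply: (dj _ _ q2); rewrite ?memE.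
  split=> //.
  (* A matching edge through both [r] and [p0] would be [a], which misses [r]; so [r] is covered by
     [w]. *)
  have [e eP re] := cv r; case: (rE re) => [p0e|<-//].
  have ea : e = a by apply: (dj _ _ p0); rewrite ?memE.
  by exfalso; move: re; rewrite ea; distinct.
left.
have bP : b \in P by have [e eP /p1E[ea|<-//]] := cv p1; rewrite -ea eP in aP.
have vP : v \notin P.
  by apply/negP => vP; apply: vb; apply: (dj _ _ p2); rewrite ?memE.
have b'P : b' \in P by have [e eP /q2E[<-//|ev]] := cv q2; rewrite -ev eP in vP.
split=> //.
by apply/negP => a'P; apply: ab'; apply: (dj _ _ q1); rewrite ?memE.
Qed.

(** Around the hexagon the edges are [a], [b], [v], [b'], [a'], [u]; the two triples are its
    alternate edges and cover the same six vertices. *)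
Lemma pendant_rotation (P : {set edge G}) :
    perfect_matching P -> [set a; a'; v]%SET \subset P ->
  perfect_matching ((P :\: [set a; a'; v]) :|: [set u; b; b'])%SET.
Proof.
move=> pmP avP; apply: perfect_matching_exchange => // [e f x|x].
  rewrite !inE -!orbA => eB fB.
  case/or3P: eB => /eqP->; case/or3P: fB => /eqP-> //; rewrite !memE => h;
    by case/orP: h => /eqP->; distinct.
have ex (c d e : edge G) : [exists f in [set c; d; e]%SET, x \in val f] =
    [|| x \in val c, x \in val d | x \in val e].
  apply/exists_inP/or3P => [[f]|].
    rewrite !inE -orbA => /or3P[]/eqP->.
    - by constructor 1.
    - by constructor 2.
    - by constructor 3.
  by case=> xe; [exists c|exists d|exists e]; rewrite // !inE eqxx ?orbT.
rewrite !ex !memE.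
by case: (x == p0); case: (x == p1); case: (x == p2); case: (x == q0);
   case: (x == q1); case: (x == q2).
Qed.

Lemma pendant_contractible (R : realType) (P : {set edge G}) :
  perfect_matching P ->
  contractible R (realization R (perfect_matching_complex G)).
Proof.
move=> pmP.
pose f (e : edge G) := if e \in [set a; a'; v]%SET then w else e.
(* A perfect matching that meets [{a, a', v}] contains [w], so [f] maps it into itself. This gives
   the contiguity to the identity. *)
have fsub (Q s : {set edge G}) : perfect_matching Q -> s \subset Q ->
    f @: s \subset Q.
  move=> pmQ /fintype.subsetP sQ.
  apply/fintype.subsetP => _ /imsetP[e /sQ eQ ->].
  rewrite /f; case: ifP => //.
  case: (pendant_matching pmQ) => -[] // h1 h2 h3 h4.
  by rewrite !inE -orbA => /or3P[]/eqP ee; move: eQ h2 h3 h4; rewrite ee => ->.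
apply: (@contractible_of_contiguous R _ _ f b) => [s|s|].
- rewrite !inE => /existsP[Q /andP[pmQ sQ]]; apply/existsP; exists Q.
  by rewrite pmQ finset.subUset sQ fsub.
- rewrite !inE => /existsP[Q /andP[pmQ sQ]].
  have fsQ := fsub _ _ pmQ sQ.
  case: (pendant_matching pmQ) => -[h1 h2 h3 h4].
    by apply/existsP; exists Q; rewrite pmQ finset.subUset finset.sub1set h1.
  (* The rotated matching contains [b], and it keeps [f @: s], which lies in [Q] and avoids the
     three removed edges. *)
  apply/existsP; exists ((Q :\: [set a; a'; v]) :|: [set u; b; b'])%SET.
  rewrite pendant_rotation //=; last first.
    by rewrite !finset.subUset !finset.sub1set h1 h2.
  rewrite finset.subUset finset.sub1set !inE eqxx !orbT /=.
  apply/fintype.subsetP => _ /imsetP[e es ->].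
  have := fintype.subsetP fsQ _ (imset_f f es).
  rewrite !inE => ->; rewrite andbT /f; case: ifP; last first.
    by rewrite !inE => ->.
  (* [w] differs from [a], [a'] and [v] because none of these contains [r]. *)
  move=> _; apply/orP; left; rewrite -orbA; apply/negP => /or3P wA.
  by move: rw; case: wA => /eqP->; distinct.
- rewrite !inE; apply/existsP; exists P; rewrite pmP.
  exact: finset.sub0set.
Qed.

End PendantHexagon.

(** * Edges and a perfect matching of the chain of hexagons *)

Section HexagonLineEdges.
Variable n : nat.

(** Natural numbers as columns allow plain arithmetic. Since [inord] sends a column beyond [n.*2] to
    0, bounds accompany its use below. *)
Definition hexline_at (i : nat) (t : bool) : hexline_vertex n := (inord i, t).
Local Notation V := hexline_at.

Lemma hexline_at_eq i j t t' : i <= n.*2 -> j <= n.*2 ->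
  (V i t == V j t') = (i == j) && (t == t').
Proof. by move=> hi hj; rewrite xpair_eqE -val_eqE /= !inordK. Qed.

Lemma hexline_atP (x : hexline_vertex n) :
  exists i t, i <= n.*2 /\ x = V i t.
Proof.
by case: x => i t; exists i, t; rewrite /V inord_val -ltnS ltn_ord.
Qed.

(** At [i = size p] the default value [y] of [nth y p i] provides the edge closing the cycle. *)
Lemma cycle_edgesP (y : hexline_vertex n) p e : uniq (y :: p) ->
  reflect (exists2 i, i <= size p & e = [set nth y (y :: p) i; nth y p i]%SET)
          (e \in cycle_edges (y :: p)).
Proof.
move=> Uc; apply: (iffP imsetP) => [[x xc ->]|[i ip ->]].
  exists (index x (y :: p)); first by rewrite -index_mem in xc.
  by rewrite nth_index // next_nth xc.
exists (nth y (y :: p) i); first exact: mem_nth.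
by rewrite next_nth mem_nth // index_uniq.
Qed.

Lemma hexagon_uniq k : k < n -> uniq (hexagon n k).
Proof.
move=> kn; rewrite /hexagon /= !inE.
by rewrite -!/(V _ _) !hexline_at_eq //; lia.
Qed.

Lemma hexline_edgesP e : e \in hexline_edges n ->
  (exists i t, i < n.*2 /\ e = [set V i t; V i.+1 t]%SET) \/
  (exists2 k, k <= n & e = [set V k.*2 true; V k.*2 false]%SET).
Proof.
case/bigcupP => -[k /= kn] _ /(cycle_edgesP _ (hexagon_uniq kn))[i].
do 6?[case: i => [|i]]; rewrite ?ltnS //= => _ ->.
- by left; exists k.*2, true; split; first lia.
- by left; exists k.*2.+1, true; split; first lia.
- by right; exists k.+1 => //; lia.
- by left; exists k.*2.+1, false; rewrite finset.setUC; split; first lia.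
- by left; exists k.*2, false; rewrite finset.setUC; split; first lia.
- by right; exists k; rewrite 1?finset.setUC //; lia.
Qed.

Lemma hexline_edge_row i t : i < n.*2 ->
  [set V i t; V i.+1 t]%SET \in hexline_edges n.
Proof.
move=> hi; have kn : i./2 < n by lia.
apply/bigcupP; exists (Ordinal kn) => //.
apply/(cycle_edgesP _ (hexagon_uniq kn)).
(* The cyclic order runs rightwards in the row [true] (positions 0, 1) and leftwards in the row
   [false] (positions 3, 4). *)
have : i = i./2.*2 \/ i = i./2.*2.+1 by lia.
move: {hi kn} (i./2) => k [] ->; case: t.
- by exists 0.
- by exists 4; rewrite // finset.setUC.
- by exists 1.
- by exists 3; rewrite // finset.setUC.
Qed.

Hypothesis n_gt0 : 0 < n.

Lemma hexline_edge_rung k : k <= n ->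
  [set V k.*2 true; V k.*2 false]%SET \in hexline_edges n.
Proof.
rewrite leq_eqVlt => /orP[/eqP->|kn].
  (* The last rung is the left side of no cell; it is the right side, at position 2, of cell
     [n.-1]. *)
  have kn : n.-1 < n by lia.
  apply/bigcupP; exists (Ordinal kn) => //.
  apply/(cycle_edgesP _ (hexagon_uniq kn)); exists 2 => //=.
  by rewrite -doubleS prednK.
apply/bigcupP; exists (Ordinal kn) => //.
by apply/(cycle_edgesP _ (hexagon_uniq kn)); exists 5; rewrite // finset.setUC.
Qed.

Lemma hexline_perfect_matching :
  exists P : {set edge (hexagon_line n)}, perfect_matching P.
Proof.
(* The matching takes the last rung and, in both rows, the edges joining columns [2j] and [2j+1] for
   [j < n]. *)
pose mu (x : hexagon_line n) : hexagon_line n :=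
  if x.1 == n.*2 :> nat then V n.*2 (~~ x.2)
  else V (if odd x.1 then x.1.-1 else x.1.+1) x.2.
have muV i t : i <= n.*2 -> mu (V i t) =
    if i == n.*2 then V n.*2 (~~ t) else V (if odd i then i.-1 else i.+1) t.
  by move=> hi; rewrite /mu /= inordK.
eexists; apply: (@perfect_matching_of_involution (hexagon_line n) mu) => x;
  have [i [t [hi ->]]] := hexline_atP x; rewrite !muV //.
- have [->|ni] := eqVneq i n.*2; first by rewrite muV // eqxx negbK.
  have [oi|oi] := boolP (odd i).
    rewrite muV; last lia.
    by rewrite ifN ?ifN; [congr V; lia | lia | lia].
  rewrite muV; last lia.
  by rewrite ifN ?ifT; [congr V; lia | lia | lia].
- have [->|ni] := eqVneq i n.*2.
    have := hexline_edge_rung (leqnn n).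
    by case: t => //; rewrite finset.setUC.
  case: ifP => oi; last by apply: hexline_edge_row; lia.
  rewrite finset.setUC -{2}(@prednK i); last by case: (i) oi.
  by apply: hexline_edge_row; lia.
Qed.

End HexagonLineEdges.

(** * The last hexagon of the chain is pendant *)

Theorem theorem2p3 (R : realType) (n : nat) (hn : 2 <= n) :
  contractible R (realization R (perfect_matching_complex (hexagon_line n))).
Proof.
have n_gt0 : 0 < n by lia.
have [P pmP] := hexline_perfect_matching n_gt0.
have nE : n.*2 = (n - 2).*2.+4 by lia.
(* The penultimate hexagon starts in column [m] and the last one in column [m.+2]. The vertex [r],
   in column [m.+1], and the edge [w] from column [m] to it belong to the penultimate hexagon, which
   exists as [n] is at least 2. *)
pose m := (n - 2).*2.
pose V i t : hexagon_line n := hexline_at n i t.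
pose row i t (h : i < n.*2) : edge (hexagon_line n) :=
  exist (fun e : {set hexagon_line n} => e \in edges (hexagon_line n)) _
    (hexline_edge_row t h).
pose rung k (h : k <= n) : edge (hexagon_line n) :=
  exist (fun e : {set hexagon_line n} => e \in edges (hexagon_line n)) _
    (hexline_edge_rung n_gt0 h).
have h0 : m < n.*2 by lia.
have h2 : m.+2 < n.*2 by lia.
have h3 : m.+3 < n.*2 by lia.
have k2 : n.-1 <= n by lia.
have Veq i j t t' : i <= n.*2 -> j <= n.*2 ->
  (V i t == V j t') = (i == j) && (t == t') by exact: hexline_at_eq.
(* This bounds the degrees: [p1], [q1] and [r] are in odd columns, which have no rung, and [p2],
   [q2] are in the last column, with no edge to the right. *)
have edgeP (e : edge (hexagon_line n)) i t : i <= n.*2 -> V i t \in val e ->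
    [\/ val e = [set V i t; V i.+1 t]%SET /\ i < n.*2,
        i > 0 /\ val e = [set V i.-1 t; V i t]%SET
      | ~~ odd i /\ val e = [set V i true; V i false]%SET].
  move=> hi; have [[j [s [hj ->]]]|[k hk ->]] := hexline_edgesP (valP e).
    rewrite !inE !Veq; try lia.
    case/orP=> /andP[/eqP-> /eqP->]; first by constructor 1.
    by constructor 2.
  rewrite !inE !Veq; try lia.
  move=> ik; have -> : i = k.*2 by case/orP: ik => /andP[/eqP].
  by constructor 3; rewrite odd_double.
apply: (@pendant_contractible (hexagon_line n)
  (V m.+2 true) (V m.+3 true) (V m.+4 true)
  (V m.+2 false) (V m.+3 false) (V m.+4 false) (V m.+1 true)
  (rung n.-1 k2) (rung n (leqnn n)) (row m true h0)
  (row m.+2 true h2) (row m.+3 true h3)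
  (row m.+2 false h2) (row m.+3 false h3)
  _ _ _ _ _ _ _ _ _ _ _ _ _ R P pmP).
- by rewrite /= !inE !Veq; lia.
- by congr [set V _ _; V _ _]%SET; lia.
- by congr [set V _ _; V _ _]%SET; lia.
- by [].
- by [].
- by [].
- by [].
- move=> e /edgeP[|[eE _]|[_ eE]|[om _]]; [lia| | |].
  + by right; apply: val_inj.
  + by left; apply: val_inj.
  + by rewrite /= odd_double in om.
- move=> e /edgeP[|[_ i]|[_ eE]|[_ eE]]; [lia|lia| |].
  + by left; apply: val_inj.
  + by right; apply: val_inj; rewrite eE /= nE.
- move=> e /edgeP[|[eE _]|[_ eE]|[om _]]; [lia| | |].
  + by right; apply: val_inj.
  + by left; apply: val_inj.
  + by rewrite /= odd_double in om.
- move=> e /edgeP[|[_ i]|[_ eE]|[_ eE]]; [lia|lia| |].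
  + by left; apply: val_inj.
  + by right; apply: val_inj; rewrite eE /= nE.
- by rewrite !inE eqxx orbT.
- move=> e /edgeP[|[eE _]|[_ eE]|[om _]]; [lia| | |].
  + by left; rewrite eE !inE eqxx orbT.
  + by right; apply: val_inj.
  + by rewrite /= odd_double in om.
Qed.
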